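(* For $s,w>0$ and positive integer $\eta\leq\frac{n}{2}$, there exists an interacting-electronic Hamiltonian $H=T+V=\sum_{j,k}\tau_{j,k}A_j^\dagger A_k+\sum_{l,m}\nu_{l,m}N_lN_m$ with $n$ spin orbitals such that $\|\tau\|=s$, $\|\nu\|_{\max}=w$, \begin{equation} \big\Vert\underbrace{[T,\ldots[T}_{p},V]]\big\Vert_{\eta}=\Omega\left(s^p w\eta\right),\qquad \big\Vert\underbrace{[V,\ldots[V}_{p},T]]\big\Vert_{\eta}=\Omega\left(\left(w\eta\right)^{p} s/n\right). \end{equation} In addition, for $u,w>0$ and positive integer $d\leq \eta\leq\frac{n}{2}$, there exists a $d$-sparse interacting-electronic Hamiltonian $H=T+V=\sum_{j,k}\tau_{j,k}A_j^\dagger A_k+\sum_{l,m}\nu_{l,m}N_lN_m$ with $n$ spin orbitals such that $\|\tau\|_{\max}=u$, $\|\nu\|_{\max}=w$, \begin{equation} \big\Vert\underbrace{[T,\ldots[T}_{p},V]]\big\Vert_{\eta}=\Omega\left(\left(ud\right)^p wd\right),\qquad \big\Vert\underbrace{[V,\ldots[V}_{p},T]]\big\Vert_{\eta}=\Omega\left(\left(wd\right)^p u\right). \end{equation}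
   Context: $A_j^\dagger$, $A_k$ are fermionic creation and annihilation operators on $n$ spin orbitals (modes), $N_l=A_l^\dagger A_l$ are occupation-number operators, and $\tau,\nu$ are $n\times n$ coefficient matrices. $\|\cdot\|$ is the spectral norm and $\|\cdot\|_{\max}$ the largest matrix element in absolute value. The interactions are called $d$-sparse if each row and column of $\tau$ and $\nu$ has at most $d$ nonzero entries. For a number-preserving operator $X$ (one commuting with $N=\sum_j N_j$), the fermionic $\eta$-seminorm is $\|X\|_\eta=\max_{|\psi_\eta\rangle,|\phi_\eta\rangle}|\langle\phi_\eta|X|\psi_\eta\rangle|$, the maximum over normalized states with exactly $\eta$ electrons. $p$ is a positive integer (the number of nested commutator layers). *)

(* Defs.v *)
From HB Require Import structures.
From mathcomp Require Import all_boot all_order all_algebra.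
From mathcomp Require Import complex.
From mathcomp Require Import boolp classical_sets reals.
Set Implicit Arguments. Unset Strict Implicit. Unset Printing Implicit Defensive.
Import Order.TTheory GRing.Theory Num.Theory.
Local Open Scope ring_scope.
Local Open Scope classical_set_scope.

Section Fermion.
Variable R : realType.
Local Notation C := R[i].

Definition cabs (z : C) : R := Num.sqrt (complex.Re z ^+ 2 + complex.Im z ^+ 2).

Variable n : nat.

(* Fock space on n spin orbitals: basis = occupation-number configurations *)
Definition config := {ffun 'I_n -> bool}.
(* operators on Fock space, as matrices indexed by configurations:
   (X psi)(a) = \sum_b X a b * psi b *)
Definition op := config -> config -> C.
Definition state := config -> C.

Definition setbit (x : config) (k : 'I_n) (b : bool) : config :=
  [ffun i => if i == k then b else x i].

Definition jw_sign (x : config) (k : 'I_n) : C :=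
  (-1) ^+ #|[set i : 'I_n | (i < k)%N && x i]|.

Definition ann (k : 'I_n) : op := fun a b =>
  if b k && (a == setbit b k false) then jw_sign b k else 0.

Definition adjoint (X : op) : op := fun a b => (X b a)^*%C.

Definition cre (k : 'I_n) : op := adjoint (ann k).

Definition opmul (X Y : op) : op := fun a b => \sum_c X a c * Y c b.
Definition opsub (X Y : op) : op := fun a b => X a b - Y a b.
Definition comm (X Y : op) : op := opsub (opmul X Y) (opmul Y X).

Definition numop (l : 'I_n) : op := opmul (cre l) (ann l).

Definition hopping (tau : 'M[C]_n) : op := fun a b =>
  \sum_(j < n) \sum_(k < n) tau j k * opmul (cre j) (ann k) a b.

Definition interaction (nu : 'M[C]_n) : op := fun a b =>
  \sum_(l < n) \sum_(m < n) nu l m * opmul (numop l) (numop m) a b.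

Definition nested_comm (p : nat) (X Y : op) : op := iter p (comm X) Y.

Definition apply_op (X : op) (psi : state) : state := fun a => \sum_b X a b * psi b.
Definition inner (phi psi : state) : C := \sum_a (phi a)^*%C * psi a.

Definition eta_state (eta : nat) (psi : state) : Prop :=
  (forall x : config, #|[set i : 'I_n | x i]| <> eta -> psi x = 0) /\
  \sum_x cabs (psi x) ^+ 2 = 1.

Definition eta_seminorm (eta : nat) (X : op) : R :=
  sup [set r : R | exists phi psi : state,
        eta_state eta phi /\ eta_state eta psi /\ r = cabs (inner phi (apply_op X psi))].

Definition vnorm (v : 'cV[C]_n) : R := Num.sqrt (\sum_i cabs (v i 0) ^+ 2).
Definition spec_norm (M : 'M[C]_n) : R :=
  sup [set r : R | exists v : 'cV[C]_n, vnorm v = 1 /\ r = vnorm (M *m v)].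

Definition max_norm (M : 'M[C]_n) : R :=
  \big[Num.max/0]_(j < n) \big[Num.max/0]_(k < n) cabs (M j k).

Definition is_hermitian (M : 'M[C]_n) : Prop := forall j k, M k j = (M j k)^*%C.
Definition real_symmetric (M : 'M[C]_n) : Prop :=
  forall l m, complex.Im (M l m) = 0 /\ M l m = M m l.

Definition sparse (d : nat) (M : 'M[C]_n) : Prop :=
  forall j : 'I_n, (#|[set k | (M j k != 0)%R]| <= d)%N /\ (#|[set k | (M k j != 0)%R]| <= d)%N.

End Fermion.

(* Main.v *)
(* One electron moves between two blocks of K modes, A and B, while the other
   eta - 1 electrons stay frozen in fixed modes.  T hops with amplitude u between
   every mode of A and every mode of B; V couples every mode of A to itself and to
   M of the frozen modes with weight w.  The uniform superpositions of the moving
   electron over A and over B span a plane invariant under T and V, on which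
   T = uK sigma_x and V = w(2M+1)|A><A|.  Commutators restrict to this plane, where
   the nested ones are explicit, so one matrix entry bounds each seminorm from below.
   Take K = 1, M = eta - 1 for the first claim (the bound on [V,...[V,T]] then beats
   the stated one by a factor n) and K = ceil(d/2), M = d - 1 for the second. *)
Require Import Defs.
From HB Require Import structures.
From mathcomp Require Import all_boot all_order all_algebra perm.
From mathcomp Require complex.
From mathcomp Require Import boolp classical_sets reals.
From mathcomp Require Import ring zify.
Import Order.TTheory GRing.Theory Num.Theory.
Local Open Scope ring_scope.

(** * Lower bounds on the seminorm from invariant subspaces *)

Section Reduction.
Set Implicit Arguments.
Unset Strict Implicit.
Import complex.
Local Open Scope complex_scope.
Variables (R : realType) (n : nat).
Local Notation C := (complex R).

Lemma cabsE (z : C) : (cabs z)%:C = `|z|.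
Proof. by rewrite normc_def. Qed.

Lemma natrC k : k%:R = (k%:R : R)%:C :> C.
Proof. by rewrite rmorph_nat. Qed.

Lemma cabs_ge0 (z : C) : 0 <= cabs z.
Proof. exact: sqrtr_ge0. Qed.

Lemma cabsM (x y : C) : cabs (x * y) = cabs x * cabs y.
Proof. by apply: complexI; rewrite rmorphM /= !cabsE normrM. Qed.

Lemma cabs_conj (z : C) : cabs (z^*)%C = cabs z.
Proof. by case: z => a b; rewrite /cabs /= sqrrN. Qed.

Lemma cabs_sum (I : finType) (F : I -> C) : cabs (\sum_i F i) <= \sum_i cabs (F i).
Proof.
rewrite -lecR cabsE rmorph_sum /=; apply: le_trans (ler_norm_sum _ _ _) _.
by apply: ler_sum => i _; rewrite -cabsE.
Qed.

Lemma cabs_real (r : R) : cabs r%:C = `|r|.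
Proof. by rewrite /cabs /= expr0n addr0 sqrtr_sqr. Qed.

Lemma sqr_cabs (z : C) : (cabs z ^+ 2)%:C = (z^*)%C * z.
Proof. by rewrite rmorphXn /= cabsE sqr_normc mulrC. Qed.

Lemma cabs_state_le1 eta (psi : state R n) x : eta_state eta psi -> cabs (psi x) <= 1.
Proof.
case=> _ h; rewrite -(@expr_le1 _ 2) ?cabs_ge0 // -h (bigD1 x) //= lerDl.
by apply: sumr_ge0 => i _; rewrite sqr_ge0.
Qed.

(** [sup] dominates the members of a set once the set is bounded. Amplitudes of normalized states
    have modulus at most 1, so the sum of the moduli of all entries of [X] is a bound. *)
Lemma eta_seminorm_ge eta (X : op R n) phi psi :
  eta_state eta phi -> eta_state eta psi ->
  cabs (inner phi (apply_op X psi)) <= eta_seminorm eta X.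
Proof.
move=> hphi hpsi; apply: ub_le_sup; last by exists phi, psi.
exists (\sum_a \sum_b cabs (X a b)) => _ [f [g [hf [hg ->]]]].
apply: le_trans (cabs_sum _) _; apply: ler_sum => a _.
rewrite cabsM cabs_conj.
apply: le_trans (ler_piMl (cabs_ge0 _) (cabs_state_le1 a hf)) _.
apply: le_trans (cabs_sum _) _; apply: ler_sum => b _.
by rewrite cabsM ler_piMr ?cabs_ge0 // (cabs_state_le1 _ hg).
Qed.

(* The span of W is invariant under X, which acts on it by the matrix x. *)
Definition intertwines m (W : 'I_m -> state R n) (X : op R n) (x : 'M[C]_m) :=
  forall j a, apply_op X (W j) a = \sum_i W i a * x i j.

Lemma apply_opmul (X Y : op R n) psi a :
  apply_op (opmul X Y) psi a = apply_op X (apply_op Y psi) a.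
Proof.
rewrite /apply_op /opmul; under eq_bigr do rewrite mulr_suml.
rewrite exchange_big; apply: eq_bigr => b _; rewrite mulr_sumr.
by apply: eq_bigr => c _; rewrite mulrA.
Qed.

Section Intertwiner.
Variables (m : nat) (W : 'I_m -> state R n).

Lemma intertwines_mul X Y x y :
  intertwines W X x -> intertwines W Y y -> intertwines W (opmul X Y) (x *m y).
Proof.
move=> hX hY j a; rewrite apply_opmul.
transitivity (\sum_i apply_op X (W i) a * y i j).
  transitivity (\sum_b X a b * apply_op Y (W j) b); first by [].
  under eq_bigr do rewrite hY mulr_sumr.
  rewrite exchange_big; apply: eq_bigr => i _; rewrite mulr_suml.
  by apply: eq_bigr => b _; rewrite mulrA.
under eq_bigr do rewrite hX mulr_suml.
rewrite exchange_big; apply: eq_bigr => i _; rewrite mxE mulr_sumr.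
by apply: eq_bigr => k _; rewrite mulrA.
Qed.

Lemma intertwines_comm X Y x y :
  intertwines W X x -> intertwines W Y y ->
  intertwines W (comm X Y) (x *m y - y *m x).
Proof.
move=> hX hY j a.
transitivity (apply_op (opmul X Y) (W j) a - apply_op (opmul Y X) (W j) a).
  by rewrite /apply_op -sumrB; apply: eq_bigr => b _; rewrite mulrBl.
rewrite (intertwines_mul hX hY) (intertwines_mul hY hX) -sumrB.
by apply: eq_bigr => i _; rewrite !mxE mulrBr.
Qed.

Lemma intertwines_nested X Y x y p :
  intertwines W X x -> intertwines W Y y ->
  intertwines W (nested_comm p X Y) (iter p (fun z => x *m z - z *m x) y).
Proof. by move=> hX hY; elim: p => //= p; apply: intertwines_comm. Qed.

(** For an orthonormal family, [x i j] is the matrix element of [X] between [W i] and [W j], so its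
    modulus is one of the values under the supremum. *)
Lemma intertwines_seminorm eta X x i j :
  (forall i, eta_state eta (W i)) ->
  (forall i j, inner (W i) (W j) = (i == j)%:R) ->
  intertwines W X x -> cabs (x i j) <= eta_seminorm eta X.
Proof.
move=> hW hO hX; rewrite (_ : x i j = inner (W i) (apply_op X (W j))).
  exact: eta_seminorm_ge.
rewrite /inner; under eq_bigr do rewrite hX mulr_sumr.
rewrite exchange_big /= (bigD1 i) //= [X in _ + X]big1 ?addr0 => [|k ki].
  under eq_bigr do rewrite mulrA.
  by rewrite -mulr_suml -/(inner (W i) (W i)) hO eqxx mul1r.
under eq_bigr do rewrite mulrA.
by rewrite -mulr_suml -/(inner (W i) (W k)) hO eq_sym (negPf ki) mul0r.
Qed.

End Intertwiner.
End Reduction.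

(** * Nested commutators of two-by-two matrices *)

Section TwoLevel.
Set Implicit Arguments.
Unset Strict Implicit.
Variable F : comPzRingType.

(** This is t times the Pauli matrix sigma_x. *)
Definition flip (t : F) : 'M[F]_2 := \matrix_(i, j) (if i != j then t else 0).
Definition proj0 (v : F) : 'M[F]_2 := \matrix_(i, j) (if (i == 0) && (j == 0) then v else 0).

Local Ltac entries := apply/matrixP => -[[|[|//]] ?] [[|[|//]] ?];
  rewrite !mxE ?big_ord_recl ?big_ord0 ?mxE /= -?val_eqE /=.

(** The off-diagonal matrix units are eigenvectors of commutation with [proj0 v], with eigenvalues v
    and -v. *)
Lemma iter_comm_proj0_flip (t v : F) p :
  iter p (fun z => proj0 v *m z - z *m proj0 v) (flip t) 0 1 = v ^+ p * t.
Proof.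
suff -> : iter p (fun z => proj0 v *m z - z *m proj0 v) (flip t) =
  \matrix_(i, j) (if i == j then 0 else if i == 0 then v ^+ p * t else (- v) ^+ p * t).
  by rewrite !mxE.
elim: p => [|p IH] /=; last rewrite IH; entries; rewrite ?exprS; ring.
Qed.

(** Commutation with sigma_x sends [proj0 1] to [D], then [D] to 2 [Z] and [Z] to 2 [D], where [D]
    is -i sigma_y and [Z] is sigma_z. The first layer brings no factor 2, hence [2 ^+ p] after p + 1
    layers. The row [inord (~~ odd p)] picks the entry 1 in column 0 of [D] or [Z]. *)
Lemma iter_comm_flip_proj0 (t v : F) p :
  iter p.+1 (fun z => flip t *m z - z *m flip t) (proj0 v) (inord (~~ odd p)) 0
    = t ^+ p.+1 * v * 2 ^+ p.
Proof.
pose D : 'M[F]_2 := \matrix_(i, j) (if i == j then 0 else if i == 0 then -1 else 1).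
pose Z : 'M[F]_2 := \matrix_(i, j) (if i != j then 0 else if i == 0 then 1 else -1).
suff -> : iter p.+1 (fun z => flip t *m z - z *m flip t) (proj0 v) =
    (t ^+ p.+1 * v * 2 ^+ p) *: (if odd p then Z else D).
  by rewrite !mxE; case: (odd p); rewrite !mxE -val_eqE /= inordK //= mulr1.
elim: p => [|p IH]; first by rewrite /D; entries; rewrite ?exprS; ring.
rewrite iterS IH /=; case: (odd p); rewrite /D /Z; entries; rewrite ?exprS; ring.
Qed.
End TwoLevel.

(** * Number operators, sparsity and max norm in general *)

Section Model.
Set Implicit Arguments.
Unset Strict Implicit.
Import complex.
Local Open Scope complex_scope.
Variables (R : realType) (n : nat).
Local Notation C := (complex R).
Implicit Types (x a b : config n) (i j k l m : 'I_n).

Lemma card_set (P : pred 'I_n) : #|[set i | P i]%classic| = #|P|.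
Proof. by apply: eq_card => i; exact: asboolb. Qed.

Lemma card_interval lo len :
  (lo + len <= n)%N -> #|[pred i : 'I_n | lo <= i < lo + len]%N| = len.
Proof.
move=> h; rewrite -sum1_card -[RHS](addKn lo) -[RHS]muln1 -sum_nat_const_nat.
rewrite (big_nat_widen _ _ _ _ _ h) (big_nat_widenl _ 0) // big_mkord.
by apply: eq_bigl => i; rewrite andbC.
Qed.

(** The only intermediate configuration is [b] with mode [l] emptied, and refilling [l] gives back
    [b]. The same Jordan-Wigner sign then occurs twice and cancels. *)
Lemma numopE l a b : numop R l a b = ((a == b) && b l)%:R.
Proof.
rewrite /numop /opmul /cre /adjoint /ann.
have [bl|/negPf bl] := boolP (b l); last first.
  by rewrite andbF big1 // => c _; rewrite mulr0.
rewrite andbT (bigD1 (setbit b l false)) //= eqxx big1 ?addr0 => [|c /negPf ->]; last first.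
  by rewrite mulr0.
have [->|ne] := eqVneq a b.
  rewrite bl eqxx /= /jw_sign rmorph_sign -exprD.
  by rewrite -signr_odd oddD addbb.
case: ifP => [/andP[al /eqP e]|_]; last by rewrite rmorph0 mul0r.
case/eqP: ne; apply/ffunP => i; move/ffunP/(_ i): e; rewrite !ffunE.
by case: eqP => // -> _; rewrite al bl.
Qed.

Lemma interactionE (nu : 'M[C]_n) a b :
  interaction nu a b = (a == b)%:R * \sum_(l | b l) \sum_(m | b m) nu l m.
Proof.
rewrite /interaction mulr_sumr [RHS]big_mkcond; apply: eq_bigr => l _.
rewrite mulr_sumr -[if _ then _ else _]/(if b l then _ else _).
transitivity (\sum_(m < n) (if b l && b m then (a == b)%:R * nu l m else 0)); last first.
  by case: (b l); rewrite -?big_mkcond //= big1.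
apply: eq_bigr => m _; rewrite /opmul (bigD1 b) //= !numopE eqxx /= big1 ?addr0 => [|c cb].
  by case: (b l); case: (b m); rewrite ?andbT ?andbF ?mulr1n ?mulr0n ?(mulr0, mul0r, mulr1) // mulrC.
by rewrite !numopE (negPf cb) mulr0.
Qed.

Lemma sparse_sub d (T : 'M[C]_n) (P : 'I_n -> pred 'I_n) :
  (forall j k, T j k = T k j) ->
  (forall j k, T j k != 0 -> P j k) -> (forall j, #|P j| <= d)%N -> sparse d T.
Proof.
move=> sym TP Pd j; rewrite !card_set.
have h : (#|[pred k | T j k != 0%R]| <= d)%N.
  by apply: leq_trans (Pd j); apply: subset_leq_card; apply/fintype.subsetP => k; apply: TP.
by split=> //; rewrite (eq_card (B := [pred k | T j k != 0])) // => k; rewrite !inE sym.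
Qed.

Lemma max_norm_eq (T : 'M[C]_n) (c : R) j k :
  (forall l m, cabs (T l m) <= c) -> cabs (T j k) = c -> max_norm T = c.
Proof.
move=> le_c eq_c; apply/eqP; rewrite eq_le; apply/andP; split.
  have c0 : 0 <= c by rewrite -eq_c cabs_ge0.
  by apply: bigmax_le => // l _; apply: bigmax_le.
rewrite -eq_c.
apply: le_trans (le_bigmax _ (fun l => \big[Num.max/0]_(m < n) cabs (T l m)) j).
exact: (le_bigmax _ (fun m => cabs (T j m)) k).
Qed.

(** * The Hamiltonian and its two block states *)

Variables (K M e : nat) (u w : R).

(* Modes [0, K) form A = block 0, modes [K, 2K) form B = block 1. *)
Definition block (s : 'I_2) : pred 'I_n := [pred i : 'I_n | s * K <= i < s * K + K]%N.
(** The first [M] of the [e] frozen modes. Keeping [M] apart from [e] lets V stay sparse when there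
    are many electrons. *)
Definition spectators : pred 'I_n := [pred i : 'I_n | 2 * K <= i < 2 * K + M]%N.

Definition hop_coeff : 'M[C]_n := \matrix_(j, k)
  (if block 0 j && block 1 k || block 1 j && block 0 k then u%:C else 0).
(** Each pair of an A mode and a spectator appears in both orders, for symmetry. The diagonal
    entries keep V nonzero when [M] is 0. *)
Definition int_coeff : 'M[C]_n := \matrix_(l, m)
  (if [|| block 0 l && (l == m), block 0 l && spectators m | spectators l && block 0 m]
   then w%:C else 0).

(* [e] is the number of frozen electrons; [o] is the mode of the moving one, if present. *)
Definition conf (o : option 'I_n) : config n :=
  [ffun i => (Some i == o) || (2 * K <= i < 2 * K + e)%N].

Definition block_state (s : 'I_2) : state R n := fun a =>
  ((Num.sqrt K%:R)^-1)%:C * \sum_(i | block s i) (a == conf (Some i))%:R.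

Lemma hop_coeff_sym j k : hop_coeff j k = hop_coeff k j.
Proof. by rewrite !mxE orbC [block 0 k && _]andbC [block 1 k && _]andbC. Qed.

Lemma hermitian_hop : is_hermitian hop_coeff.
Proof.
move=> j k; rewrite hop_coeff_sym mxE.
by case: ifP => _; rewrite ?conjc_real ?rmorph0.
Qed.

Lemma int_coeff_sym l m : int_coeff l m = int_coeff m l.
Proof.
rewrite !mxE [m == l]eq_sym; have [->|_] := eqVneq l m => //.
by rewrite !andbF /= orbC [block 0 m && _]andbC [spectators m && _]andbC.
Qed.

Lemma real_symmetric_int : real_symmetric int_coeff.
Proof.
by move=> l m; split; [rewrite mxE; case: ifP | apply: int_coeff_sym].
Qed.

Lemma block_lt s i : block s i -> (i < 2 * K)%N.
Proof. by case: s => [[|[|//]] ?]; rewrite /block /= => ?; lia. Qed.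

Lemma conf_inj s i j : block s i -> conf (Some i) = conf (Some j) -> i = j.
Proof.
move=> /block_lt si /ffunP /(_ i); rewrite !ffunE eqxx /=.
have -> : (2 * K <= i)%N = false by lia.
by rewrite orbF => /esym/eqP[].
Qed.

Lemma sum_block_state (f : config n -> C) s :
  \sum_b f b * block_state s b =
  ((Num.sqrt K%:R)^-1)%:C * \sum_(i | block s i) f (conf (Some i)).
Proof.
rewrite /block_state; under eq_bigr do rewrite mulrCA mulr_sumr.
rewrite -mulr_sumr exchange_big; congr (_ * _); apply: eq_bigr => i _.
rewrite (bigD1 (conf (Some i))) //= eqxx mulr1 big1 ?addr0 // => b /negPf ->.
by rewrite mulr0.
Qed.

Lemma block_state_conf s t l : block t l ->
  block_state s (conf (Some l)) = if s == t then ((Num.sqrt K%:R)^-1)%:C else 0.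
Proof.
move=> tl; rewrite /block_state; case: eqVneq => [->|st].
  rewrite (bigD1 l) //= eqxx big1 ?addr0 ?mulr1 // => i /andP[ti /negPf il].
  by case: eqP => // /(conf_inj tl)/esym/eqP; rewrite il.
rewrite big1 ?mulr0 // => i si; case: eqP => // /(conf_inj tl) li.
case/negP: st; move: tl si; rewrite -val_eqE li /block /=.
by case: s t => [[|[|//]] ?] [[|[|//]] ?] //= ? ?; lia.
Qed.

(** * Occupation sums, Jordan-Wigner signs and single hops *)

Lemma sum_conf (F : 'I_n -> C) i : (i < 2 * K)%N ->
  \sum_(l | conf (Some i) l) F l = F i + \sum_(l | conf None l) F l.
Proof.
move=> iK; rewrite (bigD1 i) /=; last by rewrite ffunE eqxx.
congr (_ + _); apply: eq_bigl => l; rewrite !ffunE (inj_eq Some_inj) /=.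
by case: eqP => [->|_]; rewrite ?andbT ?andbF //; lia.
Qed.

(* The frozen electrons sit above all the hopping modes, so no Jordan-Wigner sign appears. *)
Lemma jw_sign_conf o i : (i < 2 * K)%N -> (forall j, o = Some j -> i <= j)%N ->
  jw_sign R (conf o) i = 1.
Proof.
move=> iK oi; rewrite /jw_sign card_set (eq_card0 (A := _)) ?expr0 // => j.
rewrite -[LHS]/((j < i)%N && conf o j) -[RHS]/false ffunE.
case: o oi => [k /(_ k erefl)|_] /=; last by lia.
by rewrite (inj_eq Some_inj) => ki; case: eqP => [->|_]; lia.
Qed.

Lemma setbit_conf i : (i < 2 * K)%N -> setbit (conf (Some i)) i false = conf None.
Proof.
move=> iK; apply/ffunP => j; rewrite !ffunE (inj_eq Some_inj).
by case: eqP => //= ->; lia.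
Qed.

Lemma setbit_confE j a : (j < 2 * K)%N ->
  a j && (conf None == setbit a j false) = (a == conf (Some j)).
Proof.
move=> jK; apply/andP/eqP => [[aj /eqP/ffunP E]|->].
  apply/ffunP => i; have := E i; rewrite !ffunE (inj_eq Some_inj) /=.
  by case: eqP => [->|_ <-].
by rewrite setbit_conf // eqxx ffunE eqxx.
Qed.

(** Annihilation can only remove the moving electron, which leaves [conf None]; creation at [j] then
    gives [conf (Some j)]. Both signs are 1. *)
Lemma hop_conf i j k a : (i < 2 * K)%N -> (j < 2 * K)%N -> (k < 2 * K)%N ->
  opmul (cre R j) (ann R k) a (conf (Some i)) = ((k == i) && (a == conf (Some j)))%:R.
Proof.
move=> iK jK kK; rewrite /opmul /cre /adjoint /ann ffunE (inj_eq Some_inj).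
have -> : (2 * K <= k)%N = false by lia.
rewrite /= orbF; have [->|_] := eqVneq k i; last by rewrite big1 // => c _; rewrite mulr0.
rewrite setbit_conf // (bigD1 (conf None)) //= eqxx big1 ?addr0 => [|c /negPf ->]; last first.
  by rewrite mulr0.
rewrite setbit_confE // jw_sign_conf ?mulr1 // => [|l [->] //].
by case: eqP => [->|_]; rewrite ?rmorph0 // jw_sign_conf ?rmorph1 // => l [->].
Qed.

(** [rev_ord] exchanges the two blocks. *)
Lemma hopping_conf s a i : block s i ->
  hopping hop_coeff a (conf (Some i)) =
  u%:C * \sum_(j | block (rev_ord s) j) (a == conf (Some j))%:R.
Proof.
move=> si; have iK := block_lt si.
rewrite /hopping mulr_sumr [RHS]big_mkcond; apply: eq_bigr => j _.
(* The formula for a single hop holds only below 2K, so a nonzero coefficient is first shown to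
   confine both modes there. *)
have coeff k : hop_coeff j k != 0 -> (j < 2 * K)%N && (k < 2 * K)%N.
  rewrite mxE; case: ifP; last by rewrite eqxx.
  by case/orP => /andP[/block_lt -> /block_lt ->].
have term k : hop_coeff j k * opmul (cre R j) (ann R k) a (conf (Some i)) =
    if k == i then hop_coeff j k * (a == conf (Some j))%:R else 0.
  have [->|/coeff/andP[jK kK]] := eqVneq (hop_coeff j k) 0.
    by rewrite !mul0r if_same.
  by rewrite hop_conf //; case: eqP => _ //; rewrite mulr0.
under eq_bigr do rewrite term.
rewrite -big_mkcond big_pred1_eq mxE.
rewrite (_ : _ || _ = block (rev_ord s) j); first by case: ifP; rewrite ?mul0r.
by case: s si => [[|[|//]] ?]; rewrite /block /= => ?; lia.
Qed.

(** * Action of T and V on the block states *)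

Hypotheses (K_gt0 : (0 < K)%N) (le_Me : (M <= e)%N) (le_n : (2 * K + e <= n)%N).

Lemma card_block s : #|block s| = K.
Proof. by apply: card_interval; case: s => [[|[|//]] ?] /=; lia. Qed.

Lemma card_spectators : #|spectators| = M.
Proof. by apply: card_interval; lia. Qed.

Lemma card_conf s i : block s i -> #|[set j | conf (Some i) j]%classic| = e.+1.
Proof.
move=> /block_lt si; rewrite card_set.
rewrite (@eq_card _ _ [predU1 i & [pred j : 'I_n | 2 * K <= j < 2 * K + e]%N]).
  by rewrite cardU1 card_interval // inE; lia.
by move=> j; rewrite !inE -[LHS]/(conf _ j) ffunE (inj_eq Some_inj).
Qed.

Lemma block_state_orthonormal s t : inner (block_state s) (block_state t) = (s == t)%:R.
Proof.
rewrite /inner sum_block_state.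
under eq_bigr => i ti do rewrite (block_state_conf _ ti).
rewrite sumr_const card_block; case: eqP => _; last by rewrite rmorph0 mul0rn mulr0.
rewrite -[X in _ * X]mulr_natr (natrC R K) conjc_real -!(rmorphM (real_complex R)) /= mulrA.
by rewrite -invfM -expr2 sqr_sqrtr ?ler0n // mulVf // pnatr_eq0 -lt0n.
Qed.

Lemma eta_state_block_state s : eta_state e.+1 (block_state s).
Proof.
split=> [x xe|]; last first.
  apply: complexI; rewrite rmorph_sum /=; under eq_bigr do rewrite sqr_cabs.
  by rewrite -/(inner _ _) block_state_orthonormal eqxx.
rewrite /block_state big1 ?mulr0 // => i si; case: eqP => // xi.
by case: xe; rewrite xi (@card_conf s).
Qed.

Lemma sum_spectators (v : C) :
  \sum_(l | conf None l) (if spectators l then v else 0) = v *+ M.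
Proof.
rewrite -big_mkcondr (eq_bigl spectators) ?sumr_const ?card_spectators // => l.
by rewrite ffunE /spectators /=; lia.
Qed.

(** With the moving electron at [i] in A, the occupied pairs of nonzero weight are (i, i) and (i,
    spectator) in both orders, 2M + 1 in all. With it in B there are none, as frozen modes do not
    couple to each other. *)
Lemma interaction_conf s a i : block s i ->
  interaction int_coeff a (conf (Some i)) =
  (a == conf (Some i))%:R * (if s == 0 then (w * (M.*2.+1)%:R)%:C else 0).
Proof.
move=> si; have iK := block_lt si; rewrite interactionE; congr (_ * _).
have i0 : block 0 i = (s == 0).
  by case: s si => [[|[|//]] ?]; rewrite -val_eqE /block /= => ?; lia.
have core0 l : conf None l -> block 0 l = false.
  by rewrite ffunE /block /= => ?; lia.
have iS : spectators i = false by rewrite /spectators /=; lia.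
pose v : C := if s == 0 then w%:C else 0.
have left : \sum_(m | conf None m) int_coeff i m = v *+ M.
  rewrite -sum_spectators; apply: eq_bigr => m mc.
  have im : i == m = false by apply/eqP => im; move: mc; rewrite -im ffunE /=; lia.
  by rewrite mxE i0 iS core0 // im /v; case: (s == 0); case: (spectators m).
have right : \sum_(l | conf None l) \sum_(m | conf (Some i) m) int_coeff l m = v *+ M.
  rewrite -sum_spectators; apply: eq_bigr => l lc.
  rewrite sum_conf // big1 ?addr0 => [|m mc]; last by rewrite mxE !core0 // andbF.
  by rewrite mxE core0 //= i0 /v; case: (s == 0); case: (spectators l).
rewrite sum_conf // right sum_conf // left mxE i0 iS eqxx /v.
case: (s == 0) => /=; last by rewrite mul0rn !addr0.
rewrite -[w%:C *+ M](rmorphMn (real_complex R)) -!(rmorphD (real_complex R)) /=.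
by congr _%:C; rewrite -addnn -addn1 !natrD; ring.
Qed.

(** Each of the [K] source modes yields the same sum over the target block, and both blocks have the
    same normalization; the amplitudes add up coherently to uK. *)
Lemma hopping_intertwines :
  intertwines block_state (hopping hop_coeff) (flip (u * K%:R)%:C).
Proof.
move=> s a; rewrite /apply_op sum_block_state.
under eq_bigr => i si do rewrite (hopping_conf _ si).
rewrite sumr_const card_block [RHS](bigD1 (rev_ord s)) //= [X in _ = _ + X]big1 ?addr0 => [|t ts].
  rewrite mxE (_ : _ != _ = true); last by case: s => [[|[|//]] ?].
  by rewrite /block_state rmorphM rmorph_nat /= -[X in _ * X = _]mulr_natr; ring.
rewrite mxE (_ : _ != _ = false) ?mulr0 //.
by case: s t ts => [[|[|//]] ?] [[|[|//]] ?].
Qed.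

Lemma interaction_intertwines :
  intertwines block_state (interaction int_coeff) (proj0 (w * (M.*2.+1)%:R)%:C).
Proof.
move=> s a; rewrite /apply_op sum_block_state.
under eq_bigr => i si do rewrite (interaction_conf _ si).
rewrite -mulr_suml mulrA -/(block_state s a) [RHS](bigD1 s) //= [X in _ = _ + X]big1 ?addr0 => [|t ts].
  by rewrite mxE andbb.
rewrite mxE; case: andP => [[/eqP t0 /eqP s0]|_]; last by rewrite mulr0.
by rewrite t0 s0 in ts.
Qed.

(** * Seminorm bounds for the model *)

Lemma nested_hop_int_ge p : (0 < p)%N -> 0 <= u -> 0 <= w ->
  (u * K%:R) ^+ p * (w * (M.*2.+1)%:R)
  <= eta_seminorm e.+1 (nested_comm p (hopping hop_coeff) (interaction int_coeff)).
Proof.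
case: p => // p _ u_ge0 w_ge0; have h := intertwines_nested p.+1
  hopping_intertwines interaction_intertwines.
apply: le_trans (intertwines_seminorm (inord (~~ odd p)) 0
  eta_state_block_state block_state_orthonormal h).
rewrite iter_comm_flip_proj0 natrC -!rmorphXn -!rmorphM /=.
rewrite cabs_real ger0_norm; last by rewrite !mulr_ge0 ?exprn_ge0 ?mulr_ge0.
(* The factor [2 ^+ p] is at least 1 and is dropped. *)
apply: ler_peMr; last by rewrite ler1n expn_gt0.
by rewrite !mulr_ge0 ?exprn_ge0 ?mulr_ge0.
Qed.

Lemma nested_int_hop_ge p : 0 <= u -> 0 <= w ->
  (w * (M.*2.+1)%:R) ^+ p * (u * K%:R)
  <= eta_seminorm e.+1 (nested_comm p (interaction int_coeff) (hopping hop_coeff)).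
Proof.
move=> u_ge0 w_ge0; have h := intertwines_nested p
  interaction_intertwines hopping_intertwines.
apply: le_trans (intertwines_seminorm 0 1
  eta_state_block_state block_state_orthonormal h).
rewrite iter_comm_proj0_flip -!rmorphXn -!rmorphM /= cabs_real ger0_norm //.
by rewrite mulr_ge0 ?exprn_ge0 ?mulr_ge0.
Qed.

(** * Sparsity and norms of the coefficient matrices *)

Lemma sparse_hop d : (K <= d)%N -> sparse d hop_coeff.
Proof.
(* The cast of [block 0 j] selects the block opposite to [j]. A mode outside both blocks has a zero
   row, so the default block 0 is correct for it too. *)
move=> Kd; apply: (sparse_sub (P := fun j => block (inord (block 0 j)))).
- exact: hop_coeff_sym.
- move=> j k; rewrite mxE; case: ifP; last by rewrite eqxx.
  have b01 i : block 1 i -> block 0 i = false by rewrite /block /= => ?; lia.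
  case/orP => /andP[bj bk] _; rewrite ?bj ?(b01 _ bj).
    by rewrite (_ : inord _ = 1) //; apply: val_inj; rewrite /= inordK.
  by rewrite (_ : inord _ = 0) //; apply: val_inj; rewrite /= inordK.
- by move=> j; rewrite card_block.
Qed.

(** The row of an A mode holds the mode itself and [M] spectators, hence [M < d]; the row of a
    spectator holds the [K] modes of A. *)
Lemma sparse_int d : (K <= d)%N -> (M < d)%N -> sparse d int_coeff.
Proof.
move=> Kd Md.
apply: (sparse_sub (P := fun l => if block 0 l then pred_of_simpl [predU1 l & spectators] else block 0)).
- exact: int_coeff_sym.
- move=> l m; rewrite mxE; case: ifP; last by rewrite eqxx.
  have disj : block 0 l -> spectators l = false by rewrite /block /spectators /= => ?; lia.
  case: ifP disj => [_ /(_ isT) ->|_ _] /=; last by case/andP.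
  by rewrite orbF [l == m]eq_sym.
- move=> l; case: ifP => _; last by rewrite card_block.
  by rewrite cardU1 card_spectators; case: (_ \in _) => /=; lia.
Qed.

Lemma max_norm_hop : 0 <= u -> max_norm hop_coeff = u.
Proof.
move=> u_ge0.
have h0 : (0 < n)%N by lia.
have hK : (K < n)%N by lia.
apply: (@max_norm_eq _ _ (Ordinal h0) (Ordinal hK)) => [j k|]; rewrite mxE.
  by case: ifP => _; rewrite cabs_real ?normr0 ?ger0_norm.
by rewrite /block /= ifT ?cabs_real ?ger0_norm //; lia.
Qed.

Lemma max_norm_int : 0 <= w -> max_norm int_coeff = w.
Proof.
move=> w_ge0.
have h0 : (0 < n)%N by lia.
apply: (@max_norm_eq _ _ (Ordinal h0) (Ordinal h0)) => [j k|]; rewrite mxE.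
  by case: ifP => _; rewrite cabs_real ?normr0 ?ger0_norm.
by rewrite /block /= ifT ?cabs_real ?ger0_norm //= eqxx andbT; lia.
Qed.

(** For K = 1 the matrix is u times the swap of modes 0 and 1, and zero elsewhere. Row [i] is
    supported at column [f i], so coordinates are permuted and scaled by at most u. *)
Lemma spec_norm_hop : K = 1 -> 0 <= u -> spec_norm hop_coeff = u.
Proof.
move=> K1 u_ge0; have h0 : (0 < n)%N by lia.
have h1 : (1 < n)%N by lia.
pose i0 : 'I_n := Ordinal h0; pose i1 : 'I_n := Ordinal h1.
pose f := tperm i0 i1.
have T0 i k : k != f i -> hop_coeff i k = 0.
  rewrite mxE; case: ifP => // hop /eqP[]; move: hop; rewrite /block K1 /f.
  case/orP => /andP[/= ? ?].
    have -> : i = i0 by apply: val_inj => /=; lia.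
    by rewrite tpermL; apply: val_inj => /=; lia.
  have -> : i = i1 by apply: val_inj => /=; lia.
  by rewrite tpermR; apply: val_inj => /=; lia.
have T_mul (v : 'cV[C]_n) i :
    cabs ((hop_coeff *m v) i 0) = cabs (hop_coeff i (f i)) * cabs (v (f i) 0).
  rewrite mxE (bigD1 (f i)) //= big1 ?addr0 ?cabsM // => k kf.
  by rewrite T0 // mul0r.
have Tu i k : cabs (hop_coeff i k) <= u.
  by rewrite mxE; case: ifP => _; rewrite cabs_real ?normr0 ?ger0_norm.
have T_le (v : 'cV[C]_n) : vnorm v = 1 -> vnorm (hop_coeff *m v) <= u.
  move=> v1; have uE : u = Num.sqrt (u ^+ 2 * \sum_i cabs (v i 0) ^+ 2).
    by rewrite sqrtrM ?sqr_ge0 // -/(vnorm v) v1 mulr1 sqrtr_sqr ger0_norm.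
  rewrite [leRHS]uE ler_wsqrtr // mulr_sumr [leRHS](reindex_inj (@perm_inj _ f)) /=.
  apply: ler_sum => i _; rewrite T_mul exprMn; apply: ler_wpM2r; first exact: sqr_ge0.
  by rewrite lerXn2r ?nnegrE ?cabs_ge0.
(* The basis vector of mode 0 is sent to u times that of mode 1, which attains the bound. *)
pose v0 : 'cV[C]_n := \col_k (k == i0)%:R.
have v01 : vnorm v0 = 1.
  rewrite /vnorm (bigD1 i0) //= big1 ?addr0 => [|k /negPf k0].
    by rewrite mxE eqxx (cabs_real 1) normr1 expr1n sqrtr1.
  by rewrite mxE k0 (cabs_real 0) normr0 expr0n.
apply/eqP; rewrite eq_le; apply/andP; split.
  apply: ge_sup; first by exists (vnorm (hop_coeff *m v0)), v0.
  by move=> _ [v [v1 ->]]; apply: T_le.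
apply: le_trans (_ : vnorm (hop_coeff *m v0) <= _); last first.
  apply: ub_le_sup; last by exists v0.
  by exists u => _ [v [v1 ->]]; apply: T_le.
rewrite -[leLHS](ger0_norm u_ge0) -sqrtr_sqr ler_wsqrtr // (bigD1 i1) //= T_mul.
rewrite /f tpermR !mxE eqxx (cabs_real 1) normr1 mulr1 ifT ?cabs_real; last by rewrite /block K1.
by rewrite real_normK ?num_real // lerDl sumr_ge0 // => i _; rewrite sqr_ge0.
Qed.

End Model.

(** * Choice of parameters for the two claims *)

Theorem theorem2 (R : realType) (p : nat) : (0 < p)%N ->
  (exists c : R, 0 < c /\
    forall (n eta : nat) (s w : R),
      0 < s -> 0 < w -> (0 < eta)%N -> (eta.*2 <= n)%N ->
      exists tau nu : 'M[complex.complex R]_n,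
        is_hermitian tau /\ real_symmetric nu /\
        spec_norm tau = s /\ max_norm nu = w /\
        c * (s ^+ p * w * eta%:R)
          <= eta_seminorm eta (nested_comm p (hopping tau) (interaction nu)) /\
        c * ((w * eta%:R) ^+ p * s / n%:R)
          <= eta_seminorm eta (nested_comm p (interaction nu) (hopping tau)))
  /\
  (exists c : R, 0 < c /\
    forall (n d eta : nat) (u w : R),
      0 < u -> 0 < w -> (0 < d)%N -> (d <= eta)%N -> (eta.*2 <= n)%N ->
      exists tau nu : 'M[complex.complex R]_n,
        is_hermitian tau /\ real_symmetric nu /\
        sparse d tau /\ sparse d nu /\
        max_norm tau = u /\ max_norm nu = w /\
        c * ((u * d%:R) ^+ p * w * d%:R)
          <= eta_seminorm eta (nested_comm p (hopping tau) (interaction nu)) /\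
        c * ((w * d%:R) ^+ p * u)
          <= eta_seminorm eta (nested_comm p (interaction nu) (hopping tau))).
Proof.
move=> p0; split.
  exists 1; split=> // n eta s w s0 w0 eta0 eta_n.
  have [e eE] : exists e, eta = e.+1 by exists eta.-1; lia.
  have K0 : (0 < 1)%N by [].
  have Mn : (2 * 1 + e <= n)%N by lia.
  have s_ge0 := ltW s0; have w_ge0 := ltW w0.
  exists (hop_coeff n 1 s), (int_coeff n 1 e w).
  split; first exact: hermitian_hop.
  split; first exact: real_symmetric_int.
  split; first exact: (spec_norm_hop K0 (leqnn e) Mn).
  split; first exact: (max_norm_int K0 (leqnn e) Mn).
  (* With M = eta - 1, the weight 2M + 1 is 2 eta - 1, at least eta. *)
  have wE : w * eta%:R <= w * (e.*2.+1)%:R.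
    by apply: ler_wpM2l => //; rewrite ler_nat; lia.
  have n1 : 1 <= n%:R :> R by rewrite ler1n; lia.
  have := nested_hop_int_ge K0 (leqnn e) Mn p0 s_ge0 w_ge0.
  have := nested_int_hop_ge K0 (leqnn e) Mn p s_ge0 w_ge0.
  rewrite -eE !mulr1 !mul1r => VT TV; split.
    apply: le_trans TV; rewrite -mulrA; apply: ler_wpM2l => //.
    exact: exprn_ge0.
  apply: le_trans VT; rewrite ler_pdivrMr; last exact: lt_le_trans n1.
  apply: le_trans (_ : (w * (e.*2.+1)%:R) ^+ p * s <= _).
    apply: ler_wpM2r => //; apply: lerXn2r; rewrite ?nnegrE //; apply: mulr_ge0 => //.
  by rewrite ler_peMr // mulr_ge0 // exprn_ge0 // mulr_ge0.
(* Since [uphalf d] is only known to be at least d/2, each of the [p] hopping factors may lose a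
   factor 2. *)
exists (2 ^- p); split; first by rewrite invr_gt0 exprn_gt0.
move=> n d eta u w u0 w0 d0 d_eta eta_n.
have [e eE] : exists e, eta = e.+1 by exists eta.-1; lia.
have K0 : (0 < uphalf d)%N by lia.
have Me : (d.-1 <= e)%N by lia.
(* Two blocks of [uphalf d] modes take at most d + 1 modes, so with eta - 1 frozen ones the total is
   at most 2 eta. Blocks of [d] modes might not fit. *)
have Mn : (2 * uphalf d + e <= n)%N by lia.
have u_ge0 := ltW u0; have w_ge0 := ltW w0.
exists (hop_coeff n (uphalf d) u), (int_coeff n (uphalf d) d.-1 w).
split; first exact: hermitian_hop.
split; first exact: real_symmetric_int.
split; first by apply: (sparse_hop u K0 Me Mn); lia.
split; first by apply: (sparse_int w K0 Me Mn); lia.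
split; first exact: (max_norm_hop K0 Me Mn).
split; first exact: (max_norm_int K0 Me Mn).
(* M = d - 1 is the largest value that sparsity allows, and 2M + 1 = 2d - 1 is at least d. *)
have wE : w * d%:R <= w * (d.-1.*2.+1)%:R.
  by apply: ler_wpM2l => //; rewrite ler_nat; lia.
have uE : u * d%:R / 2 <= u * (uphalf d)%:R.
  rewrite -mulrA; apply: ler_wpM2l => //; rewrite ler_pdivrMr // -natrM ler_nat; lia.
have := nested_hop_int_ge K0 Me Mn p0 u_ge0 w_ge0.
have := nested_int_hop_ge K0 Me Mn p u_ge0 w_ge0.
rewrite -eE => VT TV; split.
  (* The constant is absorbed into the power as (ud/2)^p. *)
  apply: le_trans TV; rewrite -mulrA mulrA [X in X * _]mulrC -expr_div_n.
  apply: ler_pM => //; rewrite ?exprn_ge0 ?mulr_ge0 ?invr_ge0 //.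
  by apply: lerXn2r => //; rewrite nnegrE !mulr_ge0 ?invr_ge0.
apply: le_trans VT; apply: le_trans (_ : (w * d%:R) ^+ p * u <= _).
  rewrite ler_piMl ?mulr_ge0 ?exprn_ge0 ?mulr_ge0 // invf_le1 ?exprn_gt0 //.
  by rewrite exprn_ege1 // ler1n.
apply: ler_pM => //; rewrite ?exprn_ge0 ?mulr_ge0 //.
  by apply: lerXn2r => //; rewrite nnegrE mulr_ge0.
by rewrite ler_peMr // ler1n.
Qed.
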